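(* Let $[a_1,\ldots,a_n]$ be a positive continued fraction with $a_1\ge2$. Then the Jones polynomial $V_{[a_1,\ldots,a_n]}$ of the 2-bridge link $C[a_1,\ldots,a_n]$ is an alternating sum, its width is $a_1+a_2+\cdots+a_n$, and its first and its last coefficient have absolute value $1$.
   Context: A positive continued fraction is $[a_1,\ldots,a_n]=a_1+1/(a_2+1/(\cdots+1/a_n))$ with all $a_i$ positive integers. The link $C[a_1,\ldots,a_n]$ is the 2-bridge link with the alternating Conway diagram made of $n$ successive 2-strand braids with $a_1,\ldots,a_n$ crossings. Concretely: take four horizontal strands in positions $1,2,3,4$ and, from left to right, the braid $\sigma_2^{-a_1}\sigma_1^{a_2}\sigma_2^{-a_3}\cdots$ ($i$-th factor $\sigma_2^{-a_i}$ for $i$ odd, $\sigma_1^{a_i}$ for $i$ even), where $\sigma_j$ crosses the strands in positions $j,j+1$ by a crossing that is positive when both strands are oriented left to right. On the left join ends $1$–$2$ and $3$–$4$; on the right join $1$–$2$ and $3$–$4$ if $n$ is odd, and $2$–$3$ and $1$–$4$ (nested arcs) if $n$ is even. Choose any orientation of the components (changing it multiplies the Jones polynomial only by a power of $t$). Jones polynomial: $V(\text{unknot})=1$ and $t^{-1}V(L_+)-t\,V(L_-)+(t^{-1/2}-t^{1/2})V(L_0)=0$ for oriented links $L_+,L_-,L_0$ that agree except near one point, where they have a positive crossing, a negative crossing, and the oriented smoothing respectively. For these links $V\in\mathbb Z[t,t^{-1}]$ (knots) or $V\in t^{1/2}\mathbb Z[t,t^{-1}]$ (2-component links). A Laurent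 polynomial in $t$ is alternating if it can be written $\pm\sum_{i=m}^M(-1)^ic_it^i$ with $m,M\in\mathbb Z$ and $c_i\in\mathbb Z_{\ge0}$; an element of $t^{1/2}\mathbb Z[t,t^{-1}]$ is alternating if its product with $t^{-1/2}$ is. The width is the difference between the highest and the lowest exponent of $t$ occurring. The first and last coefficients are those of the terms of highest and lowest exponent. *)

(* Defs.v *)
From HB Require Import structures.
From Stdlib Require Import Relation_Operators.
From mathcomp Require Import all_boot all_order all_algebra.
From mathcomp Require Import finmap monalg.

Set Implicit Arguments.
Unset Strict Implicit.
Unset Printing Implicit Defensive.

Import GRing.Theory.
Local Open Scope ring_scope.

(* The ring Z[t^(1/2), t^(-1/2)], as the group algebra of int over int: an
   element is a finitely supported family of integer coefficients, and the
   coefficient with index k is that of t^(k/2). The library's product on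
   {malg _[_]} requires a monoid of exponents without nontrivial units, so the
   product for exponents in int is defined here. *)
Definition laurent := {malg int[int]}.
HB.instance Definition _ := GRing.Zmodule.on laurent.

Definition laurent_mul (p q : laurent) : laurent :=
  \sum_(i <- msupp p) \sum_(j <- msupp q) << p@_i * q@_j *g i + j >>.

Lemma laurent_sumw (h : int -> int -> laurent) (d : {fset int}) (q : laurent) :
    (forall j, h j 0 = 0) -> (msupp q `<=` d)%fset ->
  \sum_(j <- msupp q) h j q@_j = \sum_(j <- d) h j q@_j.
Proof.
move=> h0 le_d; apply: big_fset_incl => // j _ jq.
by rewrite (mcoeff_outdom jq) h0.
Qed.

Lemma laurent_sumD (h : int -> int -> laurent) :
    (forall j x y, h j (x + y) = h j x + h j y) ->
  {morph (fun q : laurent => \sum_(j <- msupp q) h j q@_j) : p q / p + q}.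
Proof.
move=> hD p q.
have h0 j : h j 0 = 0 by apply: (addrI (h j 0)); rewrite -hD !addr0.
rewrite (laurent_sumw h0 (msuppD_le p q)).
rewrite (laurent_sumw h0 (fsubsetUl (msupp p) (msupp q))).
rewrite (laurent_sumw h0 (fsubsetUr (msupp p) (msupp q))) -big_split /=.
by apply: eq_bigr => j _; rewrite mcoeffD hD.
Qed.

Lemma laurent_mulDl : left_distributive laurent_mul +%R.
Proof.
move=> p q r; pose h i x : laurent := \sum_(j <- msupp r) << x * r@_j *g i + j >>.
have hD j x y : h j (x + y) = h j x + h j y.
  by rewrite -big_split; apply: eq_bigr => k _; rewrite mulrDl; exact: monalgUD.
exact: (laurent_sumD hD).
Qed.

Lemma laurent_mulC : commutative laurent_mul.
Proof.
move=> p q; rewrite /laurent_mul exchange_big /=.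
by apply: eq_bigr => j _; apply: eq_bigr => i _; rewrite mulrC addrC.
Qed.

Lemma laurent_mulDr : right_distributive laurent_mul +%R.
Proof. by move=> p q r; rewrite laurent_mulC laurent_mulDl !(laurent_mulC p). Qed.

Lemma laurent_mul0 p : laurent_mul p 0 = 0.
Proof. by apply: (addrI (laurent_mul p 0)); rewrite -laurent_mulDr !addr0. Qed.

Lemma laurent_mulUU (c d i j : int) :
  laurent_mul << c *g i >> << d *g j >> = << c * d *g i + j >>.
Proof.
rewrite /laurent_mul.
pose h k x : laurent := \sum_(l <- msupp (<< d *g j >> : laurent))
  << x * << d *g j >>@_l *g k + l >>.
have h0 k : h k 0 = 0 by apply: big1 => l _; rewrite mul0r monalgU0.
rewrite (laurent_sumw h0 (msuppU_le (k := i) (x := c))) big_seq_fset1 mcoeffUU.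
rewrite /h; pose g l x : laurent := << c * x *g i + l >>.
have g0 k : g k 0 = 0 by rewrite /g mulr0 monalgU0.
by rewrite (laurent_sumw g0 (msuppU_le (k := j) (x := d))) big_seq_fset1 mcoeffUU.
Qed.

Lemma laurent_ind (P : laurent -> Prop) :
    P 0 -> (forall p q, P p -> P q -> P (p + q)) ->
    (forall c k, P << c *g k >>) ->
  forall p, P p.
Proof. by move=> P0 PD PU p; rewrite [p]monalgE; apply: big_ind. Qed.

Lemma laurent_mulA : associative laurent_mul.
Proof.
move=> p q r; have mul0 x : laurent_mul 0 x = 0 by rewrite laurent_mulC laurent_mul0.
elim/laurent_ind: p => [|p p' IH IH'|a i]; first by rewrite !mul0.
  by rewrite !laurent_mulDl IH IH'.
elim/laurent_ind: q => [|q q' IH IH'|b j]; first by rewrite !(mul0, laurent_mul0).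
  by rewrite !(laurent_mulDl, laurent_mulDr) IH IH'.
elim/laurent_ind: r => [|r r' IH IH'|c k]; first by rewrite !laurent_mul0.
  by rewrite !laurent_mulDr IH IH'.
by rewrite !laurent_mulUU mulrA addrA.
Qed.

Lemma laurent_mul1 : left_id (<< 1 *g 0 >> : laurent) laurent_mul.
Proof.
elim/laurent_ind => [|p q IH IH'|c k]; first by rewrite laurent_mul0.
  by rewrite laurent_mulDr IH IH'.
by rewrite laurent_mulUU mul1r add0r.
Qed.

Lemma laurent_1neq0 : (<< 1 *g 0 >> : laurent) != 0.
Proof. by apply/eqP => /(congr1 (fun p : laurent => p@_0)); rewrite mcoeffUU mcoeff0. Qed.

HB.instance Definition _ := GRing.Zmodule_isComNzRing.Build laurent
  laurent_mulA laurent_mulC laurent_mul1 laurent_mulDl laurent_1neq0.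

(* c * t^(k/2) *)
Definition laurent_term (c k : int) : laurent := << c *g k >>.
(* t^(k/2) *)
Definition thalf (k : int) : laurent := laurent_term 1 k.

(* +- \sum_(m <= i <= M) (-1)^i c_i t^i with c_i >= 0, where M = m + N - 1 *)
Definition alternating_int (p : laurent) : Prop :=
  exists (b : bool) (m : int) (N : nat) (c : int -> nat),
    p = (-1) ^+ b * \sum_(j < N)
          (let i : int := m + j%:Z in laurent_term ((-1) ^ i * (c i)%:Z) (2 * i)).

Definition alternating (p : laurent) : Prop :=
  alternating_int p \/ alternating_int (thalf (-1) * p).

Definition is_lowest (p : laurent) (k : int) : Prop :=
  k \in msupp p /\ forall j, j \in msupp p -> k <= j.

Definition is_highest (p : laurent) (k : int) : Prop :=
  k \in msupp p /\ forall j, j \in msupp p -> j <= k.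

(* Link diagrams cut by vertical lines into elementary tiles and read from left
   to right. Between two tiles there are finitely many strands, in positions
   0, 1, 2, ...; a tile (x, i) acts at position i and leaves the others alone.
     (Cup o, i)    creates two strands, in positions i and i+1, joined on the
                   left;
     (Cap, i)      joins on the right the strands in positions i and i+1;
     (Cross e, i)  crosses the strands in positions i and i+1, by a crossing
                   which is positive (e = true) or negative (e = false) when
                   both strands are oriented from left to right.
   Cups carry a decoration in O: unit for an unoriented diagram, bool for an
   oriented one. An orientation of a strand is a bool, true for left to right;
   (Cup o, i) gives orientation o to the strand in position i and the opposite
   one to the strand in position i+1. *)
Inductive shape (O : Type) : Type :=
  | Cup of O
  | Cap
  | Cross of bool.
Arguments Cap {O}.
Arguments Cross {O}.

Definition tile (O : Type) : Type := (shape O * nat)%type.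
Definition diagram : Type := seq (tile unit).
Definition odiagram : Type := seq (tile bool).

Definition forget (x : tile bool) : tile unit :=
  (match x.1 with Cup _ => Cup tt | Cap => Cap | Cross e => Cross e end, x.2).

(* Orientations of the strands to the right of a tile from those to its left;
   None if there are not enough strands, or if a cap joins two strands whose
   orientations do not match. *)
Definition step (w : seq bool) (x : tile bool) : option (seq bool) :=
  let i := x.2 in
  let a := nth true w i in
  let b := nth true w i.+1 in
  match x.1 with
  | Cup o => if (i <= size w)%N
             then Some (take i w ++ [:: o; ~~ o] ++ drop i w) else None
  | Cap => if (i.+1 < size w)%N && (a != b)
           then Some (take i w ++ drop i.+2 w) else None
  | Cross _ => if (i.+1 < size w)%N
               then Some (take i w ++ [:: b; a] ++ drop i.+2 w) else None
  end.

Definition run (D : odiagram) : option (seq bool) :=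
  foldl (fun w x => obind (step^~ x) w) (Some [::]) D.

Definition closed (D : odiagram) : Prop := run D = Some [::].

Definition orientation_of (D : odiagram) (C : diagram) : Prop :=
  closed D /\ map forget D = C.

Definition ends_left (O : Type) (x : shape O) : nat :=
  if x is Cup _ then 0%N else 2%N.
Definition ends_right (O : Type) (x : shape O) : nat :=
  if x is Cap then 0%N else 2%N.

(* Generating moves for isotopy of sliced diagrams: tiles at different heights
   slide past each other, a zigzag is straightened, a strand slides over or
   under a cup or a cap, and the three Reidemeister moves. In a pitchfork the
   free strand crosses one leg downwards on one side and the other leg upwards
   on the other side, hence the change from e to ~~ e. The remaining versions of
   the third Reidemeister move follow with the second one. By the theorem of
   Freyd-Yetter and Turaev, two sliced diagrams represent isotopic links if and
   only if they are related by these moves. *)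
Inductive move : odiagram -> odiagram -> Prop :=
  | move_far x y i k :
      move [:: (x, i); (y, i + ends_right x + k)%N]
           [:: (y, i + ends_left x + k)%N; (x, i)]
  | move_zigzag_l o i : move [:: (Cup o, i.+1); (Cap, i)] [::]
  | move_zigzag_r o i : move [:: (Cup o, i); (Cap, i.+1)] [::]
  | move_pitchfork_cup o e i :
      move [:: (Cup o, i.+1); (Cross e, i)] [:: (Cup o, i); (Cross (~~ e), i.+1)]
  | move_pitchfork_cap e i :
      move [:: (Cross e, i); (Cap, i.+1)] [:: (Cross (~~ e), i.+1); (Cap, i)]
  | move_R1_cup o e i : move [:: (Cup o, i); (Cross e, i)] [:: (Cup (~~ o), i)]
  | move_R1_cap e i : move [:: (Cross e, i); (Cap, i)] [:: (Cap, i)]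
  | move_R2 e i : move [:: (Cross e, i); (Cross (~~ e), i)] [::]
  | move_R3 e i : move [:: (Cross e, i); (Cross e, i.+1); (Cross e, i)]
                       [:: (Cross e, i.+1); (Cross e, i); (Cross e, i.+1)].

(* Both sides must be consistently oriented closed diagrams; this fixes the
   decorations of the cups that a move creates. *)
Inductive isotopy_step : odiagram -> odiagram -> Prop :=
  | IsotopyStep u v l r : move l r -> closed (u ++ l ++ v) ->
      closed (u ++ r ++ v) -> isotopy_step (u ++ l ++ v) (u ++ r ++ v).

Definition isotopic : odiagram -> odiagram -> Prop :=
  clos_refl_sym_trans odiagram isotopy_step.

(* With a and b the orientations, to the left of a crossing, of the strands in
   positions i and i+1: the crossing (Cross e, i) is positive exactly when
   e = (a == b). *)
Definition pos_crossing (a b : bool) (i : nat) : odiagram :=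
  [:: (Cross (a == b), i)].
Definition neg_crossing (a b : bool) (i : nat) : odiagram :=
  [:: (Cross (a != b), i)].
Definition smoothing (a b : bool) (i : nat) : odiagram :=
  if a == b then [::] else [:: (Cap, i); (Cup b, i)].

(* The Jones polynomial, through its defining properties. *)
Record is_jones (V : odiagram -> laurent) : Prop := IsJones {
  jones_isotopy : forall D D', isotopic D D' -> V D = V D';
  jones_unknot : forall o, V [:: (Cup o, 0%N); (Cap, 0%N)] = 1;
  jones_skein : forall (u v : odiagram) (w : seq bool) (i : nat),
    let a := nth true w i in
    let b := nth true w i.+1 in
    run u = Some w -> (i.+1 < size w)%N ->
    closed (u ++ pos_crossing a b i ++ v) ->
    closed (u ++ neg_crossing a b i ++ v) ->
    closed (u ++ smoothing a b i ++ v) ->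
    thalf (-2) * V (u ++ pos_crossing a b i ++ v)
      - thalf 2 * V (u ++ neg_crossing a b i ++ v)
      + (thalf (-1) - thalf 1) * V (u ++ smoothing a b i ++ v) = 0
}.

(* [a_1, ..., a_n] is given by the sequence of its partial quotients *)
Definition positive_cf (a : seq nat) : Prop :=
  (0 < size a)%N /\ all (fun x => 0 < x)%N a.

(* C[a_1, ..., a_n]. Positions and indices start from 0 here, so that sigma_j
   is at position j - 1 and nth 0 a k is a_(k+1). *)
Definition conway_braid (a : seq nat) : diagram :=
  flatten (mkseq (fun k => nseq (nth 0%N a k)
                    (if odd k then (Cross true, 0%N) else (Cross false, 1%N)))
                 (size a)).

Definition conway (a : seq nat) : diagram :=
  [:: (Cup tt, 0%N); (Cup tt, 2%N)] ++ conway_braid a ++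
  (if odd (size a) then [:: (Cap, 0%N); (Cap, 0%N)]
   else [:: (Cap, 1%N); (Cap, 0%N)]).

(* Main.v *)
(* Cut before its last caps, the diagram is a word in two crossings on four
   strands. On such words, closed in either of the two ways, the skein relation
   at the last of two equal letters, R1 and the pitchfork move determine V by
   induction on the length, and the writhe-normalized Kauffman bracket, computed
   in the two-dimensional Temperley-Lieb module, satisfies the same recursion.
   In the variable y = -t the action of the letters is subtraction-free once the
   word starts with two crossings of the first braid, which is the assumption
   a_1 >= 2. There the
   two components have supports such that each sum that occurs has its lowest term
   from one summand only and its highest term from the other one only, so both
   extreme coefficients stay equal to 1. *)
From Stdlib Require Import Relation_Operators.
From mathcomp Require Import all_boot all_order all_algebra.
From mathcomp Require Import finmap monalg.
From mathcomp Require Import ring zify.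
Require Import Defs.

Set Implicit Arguments.
Unset Strict Implicit.
Unset Printing Implicit Defensive.

Import Order.TTheory GRing.Theory Num.Theory.
Local Open Scope ring_scope.

(** * Powers of t^(1/2) *)

Lemma laurent_termM c d i j :
  laurent_term c i * laurent_term d j = laurent_term (c * d) (i + j).
Proof. exact: laurent_mulUU. Qed.

Lemma thalfD i j : thalf (i + j) = thalf i * thalf j.
Proof. by rewrite /thalf laurent_termM mulr1. Qed.

Lemma thalfNK : thalf 1 * thalf (-1) = 1.
Proof. by rewrite -thalfD subrr. Qed.

Lemma thalf2 : thalf 2 = thalf 1 * thalf 1.
Proof. by rewrite -thalfD. Qed.

Lemma thalfN2 : thalf (-2) = thalf (-1) * thalf (-1).
Proof. by rewrite -thalfD. Qed.

(** * Crossing signs and the writhe factor *)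

Definition run_from (w : seq bool) (D : odiagram) : option (seq bool) :=
  foldl (fun w x => obind (step^~ x) w) (Some w) D.

Lemma run_cat u v w : run u = Some w -> run (u ++ v) = run_from w v.
Proof. by rewrite /run foldl_cat => ->. Qed.

Fixpoint signs_from (w : seq bool) (D : odiagram) : seq bool :=
  if D is x :: D' then
    (if x.1 is Cross e then [:: e == (nth true w x.2 == nth true w x.2.+1)] else [::])
    ++ (if step w x is Some w' then signs_from w' D' else [::])
  else [::].

Lemma signs_from_cat w u v w' : run_from w u = Some w' ->
  signs_from w (u ++ v) = signs_from w u ++ signs_from w' v.
Proof.
rewrite /run_from; elim: u w => [|x u IH] w /=; first by case=> ->.
case: (step w x) => [w1|] /=; last by elim: (u).
by move=> /IH ->; rewrite catA.
Qed.

(* (-A^3)^(-1) for a positive crossing, -A^3 for a negative one, multiplied by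
   the factor A that [bracket_step] drops. *)
Definition sign_weight (e : bool) : laurent := - thalf (if e then 1 else -2).
Definition weight (w : seq bool) (D : odiagram) : laurent :=
  \prod_(e <- signs_from w D) sign_weight e.

Lemma weight_cat w u v w' : run_from w u = Some w' ->
  weight w (u ++ v) = weight w u * weight w' v.
Proof. by move=> uw; rewrite /weight (signs_from_cat _ uw) big_cat. Qed.

Lemma jones_move V (hV : is_jones V) u v l r : move l r ->
  closed (u ++ l ++ v) -> closed (u ++ r ++ v) -> V (u ++ l ++ v) = V (u ++ r ++ v).
Proof.
move=> lr cl cr; apply: (jones_isotopy hV).
by apply: rst_step; apply: IsotopyStep.
Qed.

(** * Words in two crossings and their Kauffman brackets *)

Definition letter (b : bool) : tile bool := (Cross b, nat_of_bool (~~ b)).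
Definition cups (o o' : bool) : odiagram := [:: (Cup o, 0%N); (Cup o', 2%N)].
(** The first cap of [caps b] sits on the two strands crossed by [letter b], so that a final
    [letter b] becomes a kink. *)
Definition caps (c : bool) : odiagram := [:: (Cap, nat_of_bool (~~ c)); (Cap, 0%N)].

(* The two components are the Kauffman brackets of the closures by [caps true]
   and by [caps false]. A crossing [letter true] acts as 1 + t^(1/2) U_0 and a
   crossing [letter false] as t^(1/2) + U_1, with U_0 and U_1 the Temperley-Lieb
   generators: the bracket variable satisfies A^(-2) = t^(1/2), and a factor A
   is dropped at each crossing. *)
Definition bracket_step (p : laurent * laurent) (b : bool) : laurent * laurent :=
  if b then (- (thalf 2 * p.1), p.2 + thalf 1 * p.1)
  else (thalf 1 * p.1 + p.2, - (thalf (-1) * p.2)).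
Definition bracket (W : seq bool) : laurent * laurent :=
  foldl bracket_step (- (thalf 1 + thalf (-1)), 1) W.
Definition bracket_closure (c : bool) (p : laurent * laurent) : laurent :=
  if c then p.1 else p.2.

Lemma bracket_rcons W b : bracket (rcons W b) = bracket_step (bracket W) b.
Proof. by rewrite /bracket -cats1 foldl_cat. Qed.

Definition word (o o' : bool) (W : seq bool) : odiagram := cups o o' ++ map letter W.

Lemma word_rcons o o' W b : word o o' (rcons W b) = word o o' W ++ [:: letter b].
Proof. by rewrite /word map_rcons -cats1 catA. Qed.

Lemma run_word o o' W : exists w0 w1 w2 w3,
  run (word o o' W) = Some [:: w0; w1; w2; w3].
Proof.
elim/last_ind: W => [|W b [w0 [w1 [w2 [w3 IH]]]]]; first by exists o, (~~ o), o', (~~ o').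
rewrite word_rcons (run_cat _ IH).
by case: b; do 4!eexists.
Qed.

(** * Values of V on diagrams without crossings *)

Lemma jones_trivial V (hV : is_jones V) (o o' : bool) : closed (cups o o' ++ caps false) ->
  V (cups o o' ++ caps false) = 1.
Proof.
move=> cl; rewrite -[RHS](jones_unknot hV o).
apply: (jones_move hV (u := [:: (Cup o, 0%N)])
      (v := [:: (Cap, 0%N)]) (move_zigzag_l o' 1)) => //.
by case: o cl.
Qed.

Lemma mcoeff_thalfM k p j : (thalf k * p)@_j = p@_(j - k) :> int.
Proof.
elim/laurent_ind: p => [|p q IHp IHq|c i].
- by rewrite mulr0 !mcoeff0.
- by rewrite mulrDr !mcoeffD IHp IHq.
- rewrite [_ * _](laurent_termM 1 c k i) mul1r !mcoeffU.
  by congr (_ *+ nat_of_bool _); apply/eqP/eqP; lia.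
Qed.

(** The equation makes the coefficients periodic with period 2, so one nonzero coefficient would
    recur beyond any bound on the finite support. *)
Lemma thalf_sub_reg p : (thalf (-1) - thalf 1) * p = 0 -> p = 0.
Proof.
move=> E; apply/malgP => k; rewrite mcoeff0; apply/eqP; rewrite mcoeff_eq0.
apply/negP => kp.
have shift n : p@_(k + 2 * n%:Z) = p@_k.
  elim: n => [|n IH]; first by rewrite mulr0 addr0.
  have := congr1 (fun q : laurent => q@_(k + 2 * n%:Z + 1)) E.
  rewrite mulrBl mcoeffB !mcoeff_thalfM mcoeff0 => /eqP.
  rewrite subr_eq0 addrK IH => /eqP <-; congr (p@_ _); lia.
have bnd j : j \in msupp p -> (j <= \sum_(i <- msupp p) `|i|)%R.
  move=> jp; rewrite (big_fsetD1 j jp) /=; apply: le_trans (ler_norm j) _.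
  by rewrite lerDl sumr_ge0.
set N := \sum_(i <- msupp p) `|i| in bnd.
have := bnd (k + 2 * (`|N| + `|k|).+1%N%:Z).
rewrite -mcoeff_neq0 shift mcoeff_neq0 => /(_ kp).
set n : nat := `|N|%N; set m : nat := `|k|%N.
have hn : N <= n by rewrite abszE ler_norm.
have hm : - k <= m by rewrite abszE -normrN ler_norm.
lia.
Qed.

(** In the skein relation at a one-crossing curl both crossings give the unknot by R1 and the
    smoothing gives two circles; the factor t^(-1/2) - t^(1/2) is then cancelled. *)
Lemma jones_two_circles V (hV : is_jones V) o o' :
  V [:: (Cup o, 0%N); (Cap, 0%N); (Cup o', 0%N); (Cap, 0%N)]
    = - (thalf 1 + thalf (-1)).
Proof.
(* The smoothing dictates the orientation of the second cup. A curl, absorbed either at the cup or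
   at the cap, shows that reversing it does not change V. *)
have flip d : V [:: (Cup o, 0%N); (Cap, 0%N); (Cup d, 0%N); (Cap, 0%N)] =
              V [:: (Cup o, 0%N); (Cap, 0%N); (Cup (~~ d), 0%N); (Cap, 0%N)].
  rewrite -(jones_move hV (u := [:: (Cup o, 0%N); (Cap, 0%N)]) (v := [:: (Cap, 0%N)])
     (move_R1_cup d true 0)); try by case: o d => [] [].
  rewrite -(jones_move hV (u := [:: (Cup o, 0%N); (Cap, 0%N); (Cup d, 0%N)]) (v := [::])
     (move_R1_cap true 0)); by case: o d => [] [].
have -> : V [:: (Cup o, 0%N); (Cap, 0%N); (Cup o', 0%N); (Cap, 0%N)] =
          V [:: (Cup o, 0%N); (Cap, 0%N); (Cup (~~ o), 0%N); (Cap, 0%N)].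
  by case: o o' flip => [] [] flip //; rewrite flip.
have curl e : V [:: (Cup o, 0%N); (Cross e, 0%N); (Cap, 0%N)] = 1.
  rewrite -(jones_unknot hV o).
  apply: (jones_move hV (u := [:: (Cup o, 0%N)]) (v := [::])
    (move_R1_cap e 0)); by case: (o) (e) => [] [].
have := jones_skein hV (u := [:: (Cup o, 0%N)]) (v := [:: (Cap, 0%N)])
  (w := [:: o; ~~ o]) (i := 0) erefl isT.
have neq_oN : (o == ~~ o) = false by case: o {flip curl}.
rewrite /pos_crossing /neg_crossing /smoothing [nth _ _ _]/= [nth _ _ 1]/= neq_oN /=.
rewrite !curl !mulr1 thalf2 thalfN2.
move=> /(_ ltac:(by case: (o)) ltac:(by case: (o)) ltac:(by case: (o))) E.
apply/eqP; rewrite -subr_eq0; apply/eqP/thalf_sub_reg.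
by rewrite -[RHS]E; ring.
Qed.

(** * Moves and skein relation at the last crossings *)

Lemma jones_kink V (hV : is_jones V) u w0 w1 w2 w3 b :
    run u = Some [:: w0; w1; w2; w3] -> closed (u ++ [:: letter b] ++ caps b) ->
  closed (u ++ caps b) /\ V (u ++ [:: letter b] ++ caps b) = V (u ++ caps b).
Proof.
move=> hu cl; have cl' : closed (u ++ caps b).
  by move: cl; rewrite /closed !(run_cat _ hu); case: b w0 w1 w2 w3 {hu} => [] [] [] [] [].
split=> //; case: b cl cl' => cl cl'.
  exact: (jones_move hV (v := [:: (Cap, 0%N)]) (move_R1_cap true 0)).
exact: (jones_move hV (v := [:: (Cap, 0%N)]) (move_R1_cap false 1)).
Qed.

Lemma jones_pitchfork V (hV : is_jones V) u w0 w1 w2 w3 b :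
    run u = Some [:: w0; w1; w2; w3] -> closed (u ++ [:: letter b] ++ caps (~~ b)) ->
  closed (u ++ [:: letter (~~ b)] ++ caps b) /\
  V (u ++ [:: letter b] ++ caps (~~ b)) = V (u ++ [:: letter (~~ b)] ++ caps b).
Proof.
move=> hu cl; have cl' : closed (u ++ [:: letter (~~ b)] ++ caps b).
  by move: cl; rewrite /closed !(run_cat _ hu); case: b w0 w1 w2 w3 {hu} => [] [] [] [] [].
split=> //; case: b cl cl' => cl cl'.
  exact: (jones_move hV (v := [:: (Cap, 0%N)]) (move_pitchfork_cap true 0)).
by symmetry; exact: (jones_move hV (v := [:: (Cap, 0%N)]) (move_pitchfork_cap true 0)).
Qed.

Lemma jones_cancel V (hV : is_jones V) u e i v :
    closed (u ++ [:: (Cross e, i); (Cross (~~ e), i)] ++ v) -> closed (u ++ v) ->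
  V (u ++ [:: (Cross e, i); (Cross (~~ e), i)] ++ v) = V (u ++ v).
Proof. by move=> cl cl'; apply: (jones_move hV (r := [::]) (move_R2 e i)). Qed.

Lemma skein_pos (x y z : laurent) :
    thalf (-2) * x - thalf 2 * y + (thalf (-1) - thalf 1) * z = 0 ->
  x = thalf 2 * thalf 2 * y - (thalf 1 - thalf 1 * thalf 2) * z.
Proof.
rewrite thalf2 thalfN2 => E; have H := thalfNK.
(* Subtracting [thalf 2] times the vanishing skein sum isolates [x]. *)
rewrite -[x]mul1r -[LHS]subr0 -[X in _ - X](mulr0 (thalf 2)) -E thalf2.
by ring: H.
Qed.

Lemma skein_neg (x y z : laurent) :
    thalf (-2) * x - thalf 2 * y + (thalf (-1) - thalf 1) * z = 0 ->
  y = thalf (-2) * thalf (-2) * x + (thalf (-1) * thalf (-2) - thalf (-1)) * z.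
Proof.
rewrite thalf2 thalfN2 => E; have H := thalfNK.
rewrite -[y]mul1r -[LHS]addr0 -[X in _ + X](mulr0 (thalf (-2))) -E thalfN2.
by ring: H.
Qed.

(** This is the skein relation at the second of two equal letters. Changing that crossing lets R2
    remove both. Smoothing parallel strands deletes the second letter; smoothing antiparallel ones
    leaves a zigzag, whose straightening exchanges the two closures. The letter is positive exactly
    when [b == par]. *)
Lemma jones_twist V (hV : is_jones V) u w0 w1 w2 w3 b :
    let w := [:: w0; w1; w2; w3] in
    let par := nth true w (~~ b) == nth true w (~~ b).+1 in
    let c := if par then ~~ b else b in
    let x := V (u ++ [:: letter b; letter b] ++ caps (~~ b)) in
    let y := V (u ++ caps (~~ b)) in
    let z := V (u ++ [:: letter b] ++ caps c) in
    run u = Some w -> closed (u ++ [:: letter b; letter b] ++ caps (~~ b)) ->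
  [/\ closed (u ++ caps (~~ b)), closed (u ++ [:: letter b] ++ caps c) &
    if b == par
    then thalf (-2) * x - thalf 2 * y + (thalf (-1) - thalf 1) * z = 0
    else thalf (-2) * y - thalf 2 * x + (thalf (-1) - thalf 1) * z = 0].
Proof.
move=> w par c x y z hu cl.
(* The orientations between the two letters: the first letter swaps the strands it crosses. *)
pose w' := take (~~ b) w ++ [:: nth true w (~~ b).+1; nth true w (~~ b)] ++ drop (~~ b).+2 w.
have hub : run (u ++ [:: letter b]) = Some w' by rewrite (run_cat _ hu) /w'; case: (b).
have cly : closed (u ++ caps (~~ b)).
  move: cl; rewrite /closed !(run_cat _ hu).
  by case: (b) (w0) (w1) (w2) (w3) => [] [] [] [] [].
have clz : closed (u ++ [:: letter b] ++ caps c).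
  move: cl; rewrite /closed !(run_cat _ hu) /c /par /w.
  by case: (b) (w0) (w1) (w2) (w3) => [] [] [] [] [].
set i : nat := ~~ b.
have cross_closed e : closed ((u ++ [:: letter b]) ++ [:: (Cross e, i)] ++ caps (~~ b)).
  move: cl; rewrite -catA /closed !(run_cat _ hu) /i.
  by case: (b) (w0) (w1) (w2) (w3) => [] [] [] [] [].
have crossE e : V ((u ++ [:: letter b]) ++ [:: (Cross e, i)] ++ caps (~~ b))
    = if e == b then x else y.
  move: (cross_closed e); rewrite -!catA.
  have [-> //|neb] := eqVneq e b; have -> : e = ~~ b by case: (e) (b) neb => [] [].
  by move=> clX; apply: (jones_cancel hV).
have smooth_closed :
  closed ((u ++ [:: letter b]) ++ smoothing (nth true w' i) (nth true w' i.+1) i ++ caps (~~ b)).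
  move: cl; rewrite -catA /closed !(run_cat _ hu) /w' /w /i.
  by case: (b) (w0) (w1) (w2) (w3) => [] [] [] [] [].
have smoothE :
  V ((u ++ [:: letter b]) ++ smoothing (nth true w' i) (nth true w' i.+1) i ++ caps (~~ b)) = z.
  have epar : (nth true w' i == nth true w' i.+1) = par.
    by rewrite /par /w' /w /i; case: (b); rewrite /= eq_sym.
  move: smooth_closed clz; rewrite /z /c /smoothing epar.
  case: (par); first by rewrite -!catA.
  set o := nth _ _ _; rewrite /i; case: (b) => c1 c2.
    have := jones_move hV (u := u ++ [:: letter true; (Cap, 0%N)])
      (v := [:: (Cap, 0%N)]) (move_zigzag_r o 0).
    by rewrite -!catA; apply; move: c1 c2; rewrite -!catA.
  have := jones_move hV (u := u ++ [:: letter false; (Cap, 1%N)])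
      (v := [:: (Cap, 0%N)]) (move_zigzag_l o 0).
  by rewrite -!catA; apply; move: c1 c2; rewrite -!catA.
split=> //.
have := jones_skein hV hub _ (cross_closed _) (cross_closed _) smooth_closed.
rewrite smoothE !crossE.
have -> : (nth true w' i == nth true w' i.+1) = par.
  by rewrite /par /w' /w /i; case: (b); rewrite /= eq_sym.
move=> /(_ ltac:(by rewrite /w' /i; case: (b))).
by case: (b) (par) => [] [].
Qed.

(** * The weighted bracket obeys the same relations *)

Lemma jones_twist_bracket V (hV : is_jones V) u w0 w1 w2 w3 b p :
    run u = Some [:: w0; w1; w2; w3] ->
    (forall c, closed (u ++ caps c) ->
       V (u ++ caps c) = weight [::] u * bracket_closure c p) ->
    (forall c, closed (u ++ [:: letter b] ++ caps c) ->
       V (u ++ [:: letter b] ++ caps c) =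
         weight [::] (u ++ [:: letter b]) * bracket_closure c (bracket_step p b)) ->
    closed (u ++ [:: letter b; letter b] ++ caps (~~ b)) ->
  V (u ++ [:: letter b; letter b] ++ caps (~~ b)) =
    weight [::] (u ++ [:: letter b; letter b]) *
    bracket_closure (~~ b) (bracket_step (bracket_step p b) b).
Proof.
move=> hu hx hy cl.
have [/hx -> /hy ->] := jones_twist hV hu cl.
rewrite !(weight_cat _ hu) /weight.
set par := nth _ _ _ == nth _ _ _ => E.
have s1 : signs_from [:: w0; w1; w2; w3] [:: letter b] = [:: b == par].
  by rewrite /par; case: (b).
(* The first crossing only swaps the two orientations, so both crossings have the same sign. *)
have s2 : signs_from [:: w0; w1; w2; w3] [:: letter b; letter b] = [:: b == par; b == par].
  by rewrite /par; case: (b) (w0) (w1) (w2) => [] [] [] [].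
move: E; rewrite s1 s2 !big_cons !big_nil !mulr1 /sign_weight; have H := thalfNK.
set X := V _; set W := \prod_(e <- _) _; move: X W => X W.
case: p {hx hy} => p q.
case: (b) (par) => [] []; rewrite /bracket_step /bracket_closure /=.
- by move/skein_pos ->; rewrite thalf2; ring: H.
- by move/skein_neg ->; rewrite thalf2 thalfN2; ring: H.
- by move/skein_neg ->; rewrite ?thalf2 thalfN2; ring: H.
- by move/skein_pos ->; rewrite ?thalf2 ?thalfN2; ring: H.
Qed.

(** The cap forces antiparallel strands, which fixes the sign of the kink; its weight is then
    inverse to the factor -t or -t^(-1/2) of [bracket_step]. *)
Lemma weight_kink u w0 w1 w2 w3 b p :
    run u = Some [:: w0; w1; w2; w3] -> closed (u ++ [:: letter b] ++ caps b) ->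
  weight [::] (u ++ [:: letter b]) * bracket_closure b (bracket_step p b) =
  weight [::] u * bracket_closure b p.
Proof.
move=> hu cl; rewrite (weight_cat _ hu) -mulrA; congr (_ * _); rewrite /weight.
have -> : signs_from [:: w0; w1; w2; w3] [:: letter b] = [:: ~~ b].
  move: cl; rewrite /closed !(run_cat _ hu).
  by case: b w0 w1 w2 w3 {hu} => [] [] [] [] [].
rewrite big_seq1 /sign_weight; have H := thalfNK.
by case: b {cl}; rewrite /= ?thalf2 ?thalfN2; ring: H.
Qed.

(** With p and q the components, both closures have bracket t^(1/2) p + q, and the orientations
    allowed by the caps give the two crossings the same sign. *)
Lemma weight_pitchfork u w0 w1 w2 w3 b p :
    run u = Some [:: w0; w1; w2; w3] -> closed (u ++ [:: letter b] ++ caps (~~ b)) ->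
  weight [::] (u ++ [:: letter b]) * bracket_closure (~~ b) (bracket_step p b) =
  weight [::] (u ++ [:: letter (~~ b)]) * bracket_closure b (bracket_step p (~~ b)).
Proof.
move=> hu cl; rewrite !(weight_cat _ hu) /weight.
have -> : signs_from [:: w0; w1; w2; w3] [:: letter b] =
          signs_from [:: w0; w1; w2; w3] [:: letter (~~ b)].
  move: cl; rewrite /closed !(run_cat _ hu).
  by case: b w0 w1 w2 w3 {hu} => [] [] [] [] [].
by congr (_ * _); case: b {cl}; rewrite //= addrC.
Qed.

(** * Induction on the length of the word *)

Lemma jones_empty_word V (hV : is_jones V) o o' c : closed (cups o o' ++ caps c) ->
  V (cups o o' ++ caps c) = bracket_closure c (bracket [::]).
Proof.
case: c => cl; last exact: jones_trivial.
rewrite /= -(jones_two_circles hV o o').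
by symmetry; apply: (jones_move hV (u := [:: (Cup o, 0%N)]) (v := [:: (Cap, 0%N)])
  (move_far Cap (Cup o') 0 0)); case: (o) (o') => [] [].
Qed.

(** A one-letter word offers no pair of equal letters for the skein step. Here the letter is a curl
    on the first cup, once the second cup has been slid past it. *)
Lemma jones_single_letter V (hV : is_jones V) o o' :
    closed (cups o o' ++ [:: letter true] ++ caps false) ->
  V (cups o o' ++ [:: letter true] ++ caps false) =
    weight [::] (cups o o' ++ [:: letter true]) * bracket_closure false (bracket [:: true]).
Proof.
move=> cl; have cl' : closed (cups (~~ o) o' ++ caps false) by case: (o) (o') cl => [] [].
have c1 : closed [:: (Cup o, 0%N), letter true, (Cup o', 2%N) & caps false].
  by case: (o) (o') cl => [] [].
transitivity (1 : laurent); last first.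
  rewrite /weight; have -> : signs_from [::] (cups o o' ++ [:: letter true]) = [:: false].
    by case: (o).
  by rewrite big_seq1 /sign_weight /= thalfN2; have H := thalfNK; ring: H.
rewrite -(jones_trivial hV cl').
transitivity (V [:: (Cup o, 0%N), letter true, (Cup o', 2%N) & caps false]).
  symmetry.
  exact: (jones_move hV (u := [:: (Cup o, 0%N)])
    (v := caps false) (move_far (Cross true) (Cup o') 0 0)).
exact: (jones_move hV (u := [::]) (v := (Cup o', 2%N) :: caps false) (move_R1_cup o true 0)).
Qed.

Lemma jones_word V (hV : is_jones V) o o' W c : closed (word o o' W ++ caps c) ->
  V (word o o' W ++ caps c) = weight [::] (word o o' W) * bracket_closure c (bracket W).
Proof.
have [n] := ubnP (size W); elim: n W c => // n IH W c.
case/lastP: W => [|W b].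
  by move=> _ /(jones_empty_word hV) ->; rewrite /weight /= big_nil mul1r.
rewrite size_rcons ltnS => leW.
have [w0 [w1 [w2 [w3 hu]]]] := run_word o o' W.
rewrite word_rcons bracket_rcons -catA.
have [->|neq_cb] := eqVneq c b.
  move=> cl; have [cl' ->] := jones_kink hV hu cl.
  by rewrite (weight_kink _ hu cl); apply: IH.
have {c neq_cb} -> : c = ~~ b by case: c b neq_cb => [] [].
(* The default [true] for an empty prefix selects the letter handled by [jones_single_letter]. *)
pose d0 := if W is [::] then true else last true W.
have twist d : d0 = d ->
    closed (word o o' W ++ [:: letter d] ++ caps (~~ d)) ->
  V (word o o' W ++ [:: letter d] ++ caps (~~ d)) =
  weight [::] (word o o' W ++ [:: letter d]) *
  bracket_closure (~~ d) (bracket_step (bracket W) d).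
  rewrite {}/d0; case/lastP: W {hu w0 w1 w2 w3} leW => [|W d'] leW.
    by move=> <-; apply: jones_single_letter.
  have -> : (if rcons W d' is [::] then true else last true (rcons W d')) = d'.
    by rewrite last_rcons; case: (W).
  move=> ->; rewrite word_rcons bracket_rcons -!catA.
  rewrite size_rcons in leW.
  have [w0 [w1 [w2 [w3 hu]]]] := run_word o o' W.
  apply: (jones_twist_bracket hV hu) => c; first by apply: IH; apply: ltnW.
  by rewrite catA -word_rcons -bracket_rcons; apply: IH; rewrite size_rcons.
(* Otherwise the pitchfork move turns the last letter into the one before it. *)
have [/twist //|neq_b] := eqVneq d0 b.
move=> cl; have [cl' ->] := jones_pitchfork hV hu cl.
rewrite (weight_pitchfork _ hu cl).
by have := twist (~~ b); rewrite negbK; apply=> //; case: (b) (d0) neq_b => [] [].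
Qed.

(** * Alternating polynomials with extreme coefficients 1 *)

(* p = \sum_(l <= j <= h) c_j t^(r/2) (-t)^j with c_j >= 0 and c_l = c_h = 1 *)
Definition alt_span (r l h : int) (p : laurent) : Prop :=
  [/\ forall k, p@_k != 0 -> exists j, k = r + 2 * j /\ (l <= j <= h),
      forall j, 0 <= (-1) ^ j * p@_(r + 2 * j),
      (-1) ^ l * p@_(r + 2 * l) = 1 & (-1) ^ h * p@_(r + 2 * h) = 1].

Lemma alt_span_outside r l h p j : alt_span r l h p -> ~~ (l <= j <= h) ->
  p@_(r + 2 * j) = 0.
Proof.
case=> supp _ _ _ nj; apply/eqP/negPn/negP => /supp [j' [/addrI /mulfI E]].
by rewrite -(E isT) (negbTE nj).
Qed.

Lemma alt_span_thalf k r l h p : alt_span r l h p ->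
  alt_span (k + r) l h (thalf k * p).
Proof.
have E j : k + r + 2 * j - k = r + 2 * j by ring.
case=> supp pos lo hi; split=> [j|j||]; rewrite mcoeff_thalfM ?E //.
by case/supp => i [ei li]; exists i; split=> //; lia.
Qed.

Lemma signrzS (i : int) : (-1) ^ (i + 1) = - (-1) ^ i :> int.
Proof. by rewrite exprzDr // expr1z mulrN1. Qed.

(** Shifting j by one flips (-1)^j, and the change of [r] keeps the exponents fixed, so the minus
    sign is absorbed. *)
Lemma alt_spanN r l h p : alt_span r l h p ->
  alt_span (r - 2) (l + 1) (h + 1) (- p).
Proof.
have E j : r - 2 + 2 * (j + 1) = r + 2 * j by ring.
case=> supp pos lo hi; split=> [k|j||].
- rewrite mcoeffN oppr_eq0 => /supp [i [-> li]].
  by exists (i + 1); split; [rewrite E|lia].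
- by rewrite -[j](subrK 1) E mcoeffN signrzS mulrNN.
- by rewrite E mcoeffN signrzS mulrNN.
- by rewrite E mcoeffN signrzS mulrNN.
Qed.

Lemma alt_spanN_sym r l h p : alt_span r l h p ->
  alt_span (r + 2) (l - 1) (h - 1) (- p).
Proof.
have E j : r + 2 + 2 * (j - 1) = r + 2 * j by ring.
have S j : (-1) ^ (j - 1) = - (-1) ^ j :> int by rewrite -[in RHS](subrK 1 j) signrzS opprK.
case=> supp pos lo hi; split=> [k|j||].
- rewrite mcoeffN oppr_eq0 => /supp [i [-> li]].
  by exists (i - 1); split; [rewrite E|lia].
- by rewrite -[j](addrK 1) E mcoeffN S mulrNN.
- by rewrite E mcoeffN S mulrNN.
- by rewrite E mcoeffN S mulrNN.
Qed.

(** The strict inequalities leave the lowest term to [p] alone and the highest to [q] alone. *)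
Lemma alt_spanD r l h l' h' p q : l < l' -> h < h' ->
  alt_span r l h p -> alt_span r l' h' q -> alt_span r l h' (p + q).
Proof.
move=> ll hh sp sq; have := alt_span_outside sq (j := l); have := alt_span_outside sp (j := h').
case: sp sq => [p1 p2 p3 p4] [q1 q2 q3 q4] ph ql; split=> [k|j||].
- rewrite mcoeffD; have [->|/p1 [j [-> ?]] _] := eqVneq (p@_k) 0; last by exists j; lia.
  by rewrite add0r => /q1 [j [-> ?]]; exists j; lia.
- by rewrite mcoeffD mulrDr addr_ge0.
- by rewrite mcoeffD ql ?addr0 //; lia.
- by rewrite mcoeffD ph ?add0r //; lia.
Qed.

Lemma signrzK (i : int) : (-1) ^ i * (-1) ^ i = 1 :> int.
Proof. by rewrite expN1r -expr2 sqrr_sign. Qed.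

Lemma alt_span_term r i : alt_span r i i (laurent_term ((-1) ^ i) (r + 2 * i)).
Proof.
split=> [k|j||]; rewrite ?mcoeffUU ?signrzK //.
  by rewrite mcoeffU; have [<- _|_ /eqP //] := eqVneq (r + 2 * i) k; exists i; rewrite lexx.
rewrite mcoeffU; case: eqP => [ij|_]; last by rewrite mulr0.
have <- : i = j by lia.
by rewrite signrzK.
Qed.

Lemma laurent_termN1 k : laurent_term (-1) k = - thalf k.
Proof. exact: monalgUN. Qed.

(** * Spans of the two bracket components *)

(* Up to powers of t^(1/2), with y = -t and (h, g) the two components, the first
   one times t^(1/2), the letters act by (h, g) |-> (y h, h + g) and
   (h, g) |-> (h + g, y^(-1) g), which preserve positivity; the first two letters
   lead to (y + y^(-1), y^(-2)). *)
Lemma bracket_span W : let V := [:: false, false & W] in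
  exists r lN hN lS hS,
  [/\ alt_span r lN hN (bracket V).2, alt_span (r - 1) lS hS (bracket V).1,
      lN < lS /\ hN < hS, hS - lN = (size V).+1 &
      if last false W then hS = hN + 1 else lS = lN + 1].
Proof.
elim/last_ind: W => [|W b IH] V.
  (* Here the second component is t^(-1) = t y^(-2), and the first is -t^(-1/2) - t^(3/2) = t^(1/2)
     (y^(-1) + y). *)
  exists 2, (-2), (-2), (-1), 1; split=> //.
    have -> : (bracket V).2 = laurent_term ((-1) ^ (-2)) (2 + 2 * (-2)).
      by rewrite /= mulr1 mulrN opprK -thalfD.
    exact: alt_span_term.
  have -> : (bracket V).1 = - thalf (-1) + - (thalf 1 * thalf 1 * thalf 1).
    by have H := thalfNK; rewrite /=; ring: H.
  rewrite -!thalfD -!laurent_termN1; apply: (@alt_spanD _ (-1) (-1) 1 1) => //.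
    exact: (alt_span_term 1 (-1)).
  exact: (alt_span_term 1 1).
case: IH => r [lN [hN [lS [hS [sN sS [ll hh] sz la]]]]].
rewrite {}/V -2!rcons_cons bracket_rcons size_rcons last_rcons.
have sS' : alt_span r lS hS (thalf 1 * (bracket [:: false, false & W]).1).
  by have := alt_span_thalf 1 sS; rewrite addrC subrK.
case: b; rewrite /bracket_step [(_, _).1]/= [(_, _).2]/=.
  exists r, lN, hS, (lS + 1), (hS + 1); split=> //; try lia; first exact: alt_spanD sN sS'.
  by have := alt_spanN (alt_span_thalf 2 sS); congr alt_span; ring.
(* The new first component is based at the old [r], which therefore becomes [r + 1]; relative to
   this base the second one is multiplied by y^(-1). *)
exists (r + 1), (lN - 1), (hN - 1), lN, hS; split=> //; try lia.
  by have := alt_spanN_sym (alt_span_thalf (-1) sN); congr alt_span; ring.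
by rewrite addrK addrC; exact: alt_spanD sN sS'.
Qed.

(** In the closure where the last letter is not a kink, the last clause of [bracket_span] removes
    the excess 1 from [(size V).+1]. *)
Lemma bracket_closure_span W : let V := [:: false, false & W] in
  exists r l h, alt_span r l h (bracket_closure (~~ last true V) (bracket V)) /\
    h - l = (size V)%:Z.
Proof.
move=> V; have [r [lN [hN [lS [hS [sN sS _ sz]]]]]] := bracket_span W.
have -> : last true V = last false W by [].
case: (last false W) => /= e.
  by exists r, lN, hN; split; [exact: sN|move: sz e; rewrite /=; lia].
by exists (r - 1), lS, hS; split; [exact: sS|move: sz e; rewrite /=; lia].
Qed.

(** * From the bracket to the Conway diagrams *)

Lemma weight_unit D : exists (b : bool) m, weight [::] D = (-1) ^+ b * thalf m.
Proof.
rewrite /weight; elim: (signs_from _ _) => [|e s [b [m IH]]].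
  by exists false, 0; rewrite big_nil mul1r.
exists (~~ b), ((if e then 1 else -2) + m); rewrite big_cons IH /sign_weight thalfD.
by case: b {IH}; rewrite /= ?expr0 ?expr1; ring.
Qed.

Lemma alternating_int_span (b : bool) m l h p : alt_span (2 * m) l h p ->
  alternating_int ((-1) ^+ b * p).
Proof.
move=> sp; have [supp pos _ _] := sp.
(* The term of exponent m + j in t has sign (-1)^j instead of (-1)^(m + j), so the parity of [m]
   moves into the global sign. *)
exists (b (+) odd (absz m)), (m + l), (absz (h - l + 1)), (fun i => absz p@_(2 * i)).
have pE : p = \sum_(j < absz (h - l + 1))
   (let i : int := m + l + j%:Z in laurent_term ((-1) ^ (m + i) * (absz p@_(2 * i))%:Z) (2 * i)).
  apply/malgP => k; rewrite raddf_sum /=.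
  have [pk|/supp [j [-> /andP[lj jh]]]] := eqVneq p@_k 0.
    rewrite pk big1 // => j _; rewrite mcoeffU.
    by have [->|//] := eqVneq (2 * (m + l + j%:Z)) k; rewrite pk mulr0.
  have ltN : (absz (j - l) < absz (h - l + 1)%R)%N by lia.
  rewrite (bigD1 (Ordinal ltN)) //= big1 => [|i]; last first.
    rewrite -val_eqE /= mcoeffU => ne.
    by have [|//] := eqVneq (2 * (m + l + i%:Z)) (2 * m + 2 * j); lia.
  have -> : m + l + absz (j - l) = m + j by lia.
  rewrite addr0 mcoeffU mulrDr eqxx mulr1n abszE !exprzDr // [_ * (_ * _)]mulrA signrzK mul1r.
  transitivity ((-1) ^ j * ((-1) ^ j * p@_(2 * m + 2 * j))).
    by rewrite mulrA signrzK mul1r.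
  congr (_ * _).
  by rewrite -(ger0_norm (pos j)) normrM expN1r normr_sign mul1r.
rewrite signr_addb signr_odd -mulrA; congr (_ * _).
rewrite {1}pE big_distrr; apply: eq_bigr => j _ /=.
have -> : (-1) ^+ absz m = laurent_term ((-1) ^ m) 0 :> laurent.
  rewrite expN1r -signr_odd -[in RHS]signr_odd; case: odd => //.
  by rewrite /= !expr1 laurent_termN1.
by rewrite laurent_termM add0r mulrA -exprzDr.
Qed.

Lemma forget_inj_cupless (D E : odiagram) :
    all (fun x => if x.1 is Cup _ then false else true) E ->
  map forget D = map forget E -> D = E.
Proof.
elim: E D => [|[y j] E IH] [|[x i] D] //= /andP[ny nE] [exy -> /(IH _ nE) ->].
by case: x y ny exy => [o||e] [o'||e'] //= _ [] ->.
Qed.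

(** Blocks of even index consist of [letter false], the inverse of sigma_2, and those of odd index
    of [letter true], which is sigma_1. *)
Definition conway_word (a : seq nat) : seq bool :=
  flatten (mkseq (fun k => nseq (nth 0%N a k) (odd k)) (size a)).

Lemma conway_orientation a D : orientation_of D (conway a) ->
  exists o o', D = word o o' (conway_word a) ++ caps (odd (size a)).
Proof.
case=> _; have -> : conway a = [:: (Cup tt, 0%N); (Cup tt, 2%N)] ++
    map forget (map letter (conway_word a) ++ caps (odd (size a))).
  congr (_ ++ _); rewrite map_cat -map_comp; congr (_ ++ _); last by case: odd.
  rewrite /conway_braid /conway_word map_flatten; congr flatten.
  rewrite /mkseq -map_comp; apply: eq_map => k /=; rewrite map_nseq.
  by congr nseq; case: odd.
case: D => [|[[o||e] i] [|[[o'||e'] j] D]] //= [-> -> /forget_inj_cupless E].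
exists o, o'; rewrite -E // all_cat andbT.
by elim: (conway_word a).
Qed.

(** The bound on a_1 supplies the first two letters; the last partial quotient is positive, so its
    block is nonempty and fixes the last letter. *)
Lemma conway_word_spec a : positive_cf a -> (2 <= head 0 a)%N ->
  exists W, [/\ conway_word a = [:: false, false & W],
    size (conway_word a) = sumn a & last true (conway_word a) = ~~ odd (size a)].
Proof.
case=> a_gt0 pos a1.
have sz : size (conway_word a) = sumn a.
  rewrite /conway_word size_flatten; congr sumn.
  rewrite -[RHS](mkseq_nth 0%N) /seq.shape /mkseq -map_comp.
  by apply: eq_map => k /=; exact: size_nseq.
have : exists W, conway_word a = [:: false, false & W].
  case: a a1 {a_gt0 pos sz} => [|[|[|n]] a] //= _.
  by eexists; rewrite /conway_word /mkseq /=.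
case=> W e; exists W; split=> //.
case/lastP: a a_gt0 pos {a1 sz e} => [//|a k] _; rewrite all_rcons => /andP[k0 _].
rewrite /conway_word size_rcons mkseqS flatten_rcons nth_rcons ltnn eqxx last_cat negbK.
by case: k k0 => //= k _; elim: k.
Qed.

Theorem corollary7p2 (V : odiagram -> laurent) (hV : is_jones V)
    (a : seq nat) (ha : positive_cf a) (ha1 : (2 <= head 0 a)%N)
    (D : odiagram) (hD : orientation_of D (conway a)) :
  alternating (V D) /\
  exists lo hi : int,
    [/\ is_lowest (V D) lo, is_highest (V D) hi,
        hi - lo = 2 * (sumn a)%:Z,
        `|(V D)@_hi| = 1 & `|(V D)@_lo| = 1].
Proof.
have [o [o' eD]] := conway_orientation hD.
have [W [eW sW lW]] := conway_word_spec ha ha1.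
have cl : closed D by case: hD.
have [r [l [h [sp hl]]]] := bracket_closure_span W.
rewrite eD in cl *; rewrite (jones_word hV cl).
have [b [m ->]] := weight_unit (word o o' (conway_word a)).
have {sp} : alt_span r l h (bracket_closure (odd (size a)) (bracket (conway_word a))).
  by rewrite -[odd _]negbK -lW eW.
rewrite -mulrA => /(alt_span_thalf m).
move: (thalf m * _) (m + r) => p {}r sp; split.
  (* Exponents count half powers of t: the parity of [r] decides between integral powers and an
     extra factor t^(1/2). *)
  have [n [d er]] : exists n (d : bool), r = 2 * n + d%:Z.
    by exists (r %/ 2)%Z, ((r %% 2)%Z == 1); lia.
  case: d er => er; [right|left].
    rewrite mulrCA; apply: (@alternating_int_span _ n l h).
    by have := alt_span_thalf (-1) sp; congr alt_span; lia.
  by apply: (@alternating_int_span _ n l h); move: sp; congr alt_span; lia.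
have E j : ((-1) ^+ b * p)@_j = (-1) ^+ b * p@_j.
  by case: b; rewrite ?expr0 ?expr1 ?mul1r // !mulN1r mcoeffN.
have norm1 j : (-1) ^ j * p@_(r + 2 * j) = 1 -> `|((-1) ^+ b * p)@_(r + 2 * j)| = 1.
  by move/(congr1 Num.norm); rewrite E !normrM expN1r !normr_sign !mul1r normr1.
have in_supp j : `|((-1) ^+ b * p)@_(r + 2 * j)| = 1 -> r + 2 * j \in msupp ((-1) ^+ b * p).
  by rewrite -mcoeff_neq0 -normr_gt0 => ->.
have supp j : j \in msupp ((-1) ^+ b * p) -> r + 2 * l <= j <= r + 2 * h.
  rewrite -mcoeff_neq0 E mulf_eq0 signr_eq0 /=.
  by case: sp => supp _ _ _ /supp [i [-> ?]]; lia.
case: (sp) => _ _ /norm1 nl /norm1 nh.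
exists (r + 2 * l), (r + 2 * h); split=> //.
- by split=> [|j /supp /andP[]//]; exact: in_supp.
- by split=> [|j /supp /andP[]//]; exact: in_supp.
- by rewrite -sW eW -hl; ring.
Qed.
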